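(* Let $\mathbb{D}\in\{\mathbb{R},\mathbb{C},\mathbb{H}\}$, let $f:(0,\infty)\to(0,\infty)$ be a continuous function with $f(1)=1$, let $\hat{\sigma}_f$ be the alternative mean associated with $f$, and let $g:(0,\infty)\to(0,\infty)$ be given by $g(t)=f(\sqrt{t})^2$. Let $A,B\in\mathscr{P}_n(\mathbb{D})$. Suppose that $AB=BA$ and that $g$ is strictly convex or strictly concave. Then $A\,\hat{\sigma}_f\,B$ is linearizable if and only if $|\mathrm{Spec}(A^{-1}B)|\leq 2$.
   Context: $\mathscr{P}_n(\mathbb{D})$ is the set of $n\times n$ matrices $A$ over $\mathbb{D}$ that are Hermitian ($A=A^*$, with $A^*$ the conjugate transpose) and positive ($x^*Ax>0$ for all nonzero $x\in\mathbb{D}^n$). $\mathrm{Spec}(X)$ is the set of eigenvalues of $X$ (right eigenvalues when $\mathbb{D}=\mathbb{H}$), without multiplicity. For a continuous $f:(0,\infty)\to\mathbb{R}$ and $X=U\,\mathrm{diag}(\lambda_1,\dots,\lambda_n)\,U^*\in\mathscr{P}_n(\mathbb{D})$ with $UU^*=\mathrm{Id}_n$, set $f(X)=U\,\mathrm{diag}(f(\lambda_1),\dots,f(\lambda_n))\,U^*$; real powers $X^s$ are defined this way. The geometric mean is $A\sharp B=A^{1/2}(A^{-1/2}BA^{-1/2})^{1/2}A^{1/2}$. The alternative mean associated with $f$ is the operation $\hat{\sigma}_f:\mathscr{P}_n(\mathbb{D})\times\mathscr{P}_n(\mathbb{D})\to\mathscr{P}_n(\mathbb{D})$ given by $A\,\hat{\sigma}_f\,B=f(A^{-1}\sharp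 B)\,A\,f(A^{-1}\sharp B)$. $A\,\hat{\sigma}_f\,B$ is called linearizable if there exist $\alpha,\beta\in\mathbb{R}$ with $A\,\hat{\sigma}_f\,B=\alpha A+\beta B$. *)

(* Defs.v *)
From HB Require Import structures.
From mathcomp Require Import all_boot all_order all_algebra.
From mathcomp Require Import complex ring.
From mathcomp Require Import all_classical all_reals all_analysis.
Set Implicit Arguments.
Unset Strict Implicit.
Unset Printing Implicit Defensive.

Import Order.TTheory GRing.Theory Num.Theory.

Local Open Scope classical_set_scope.
Local Open Scope ring_scope.

(* [Quat a b c d] is a + b i + c j + d k. *)
Record quaternion (R : Type) := Quat { qre : R; qi : R; qj : R; qk : R }.

Section QuaternionChoice.
Variable R : Type.

Definition tuple_of_quat (x : quaternion R) : R * R * R * R :=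
  let: Quat a b c d := x in (a, b, c, d).
Definition quat_of_tuple (t : R * R * R * R) : quaternion R :=
  let: (a, b, c, d) := t in Quat a b c d.

Lemma tuple_of_quatK : cancel tuple_of_quat quat_of_tuple.
Proof. by case. Qed.

End QuaternionChoice.

HB.instance Definition _ (R : eqType) :=
  Equality.copy (quaternion R) (can_type (@tuple_of_quatK R)).
HB.instance Definition _ (R : choiceType) :=
  Choice.copy (quaternion R) (can_type (@tuple_of_quatK R)).

Section QuaternionRing.
Variable R : comNzRingType.
Local Notation H := (quaternion R).

Definition quat0 : H := Quat 0 0 0 0.
Definition quat1 : H := Quat 1 0 0 0.
Definition oppq (x : H) : H :=
  let: Quat a b c d := x in Quat (- a) (- b) (- c) (- d).
Definition addq (x y : H) : H :=
  let: Quat a b c d := x in let: Quat a' b' c' d' := y in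
  Quat (a + a') (b + b') (c + c') (d + d').

(* The Hamilton product: i^2 = j^2 = k^2 = ijk = -1. *)
Definition mulq (x y : H) : H :=
  let: Quat a b c d := x in let: Quat a' b' c' d' := y in
  Quat (a * a' - b * b' - c * c' - d * d')
       (a * b' + b * a' + c * d' - d * c')
       (a * c' - b * d' + c * a' + d * b')
       (a * d' + b * c' - c * b' + d * a').

Definition conjq (x : H) : H :=
  let: Quat a b c d := x in Quat a (- b) (- c) (- d).

Fact addqA : associative addq.
Proof. by move=> [????] [????] [????] /=; rewrite !addrA. Qed.
Fact addqC : commutative addq.
Proof. by move=> [????] [????] /=; congr Quat; rewrite addrC. Qed.
Fact add0q : left_id quat0 addq.
Proof. by move=> [????] /=; rewrite !add0r. Qed.
Fact addNq : left_inverse quat0 oppq addq.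
Proof. by move=> [????] /=; rewrite !addNr. Qed.

HB.instance Definition _ := GRing.isZmodule.Build H addqA addqC add0q addNq.

Fact mulqA : associative mulq.
Proof. by move=> [????] [????] [????] /=; congr Quat; ring. Qed.
Fact mul1q : left_id quat1 mulq.
Proof. by move=> [????] /=; congr Quat; ring. Qed.
Fact mulq1 : right_id quat1 mulq.
Proof. by move=> [????] /=; congr Quat; ring. Qed.
Fact mulqDl : left_distributive mulq addq.
Proof. by move=> [????] [????] [????] /=; congr Quat; ring. Qed.
Fact mulqDr : right_distributive mulq addq.
Proof. by move=> [????] [????] [????] /=; congr Quat; ring. Qed.
Fact oneq_neq0 : quat1 != 0 :> H.
Proof. by apply/eqP => -[] /eqP; rewrite oner_eq0. Qed.

HB.instance Definition _ := GRing.Zmodule_isNzRing.Build H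
  mulqA mul1q mulq1 mulqDl mulqDr oneq_neq0.

End QuaternionRing.

Inductive scalar_kind := RealScalars | ComplexScalars | QuaternionScalars.

Definition scalarD (R : realType) (D : scalar_kind) : nzRingType :=
  match D with
  | RealScalars => R
  | ComplexScalars => complex R
  | QuaternionScalars => quaternion R
  end.

Definition conjD (R : realType) (D : scalar_kind) :
    scalarD R D -> scalarD R D :=
  match D return scalarD R D -> scalarD R D with
  | RealScalars => fun x => x
  | ComplexScalars => fun z => conjc z
  | QuaternionScalars => fun q => conjq q
  end.

Definition of_real (R : realType) (D : scalar_kind) : R -> scalarD R D :=
  match D return R -> scalarD R D with
  | RealScalars => fun r => r
  | ComplexScalars => fun r => Complex r 0
  | QuaternionScalars => fun r => Quat r 0 0 0
  end.
Arguments of_real {R} D r.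

Section Matrices.
Variables (R : realType) (D : scalar_kind).

Definition conjtrmx m n (A : 'M[scalarD R D]_(m, n)) : 'M[scalarD R D]_(n, m) :=
  map_mx (@conjD R D) A^T.

Definition hermmx n (A : 'M[scalarD R D]_n) : Prop := A = conjtrmx A.

(* x^* A x > 0 means that the 1 x 1 matrix x^* A x is a positive real. *)
Definition posdefmx n (A : 'M[scalarD R D]_n) : Prop :=
  hermmx A /\
  forall x : 'cV[scalarD R D]_n, x != 0 ->
    exists2 r : R, 0 < r & conjtrmx x *m A *m x = (of_real D r)%:M.

(* Right eigenvalues, X x = x l; the side matters only for quaternions. *)
Definition Spec n (X : 'M[scalarD R D]_n) : set (scalarD R D) :=
  [set l | exists2 x : 'cV[scalarD R D]_n,
     x != 0 & X *m x = \col_i (x i 0 * l)].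

(* The library's [invmx] needs a commutative ring of coefficients. *)
Definition invmxD n (X : 'M[scalarD R D]_n) : 'M[scalarD R D]_n :=
  xget 0 [set Y | X *m Y = 1%:M /\ Y *m X = 1%:M].

Definition real_diag n (l : 'I_n -> R) : 'M[scalarD R D]_n :=
  diag_mx (\row_i of_real D (l i)).

(* [Y] is a value of f(X): Y = U diag(f(l_i)) U^* for some diagonalization
   X = U diag(l_i) U^* with U U^* = Id and all l_i > 0. *)
Definition is_mxfun (f : R -> R) n (X Y : 'M[scalarD R D]_n) : Prop :=
  exists (U : 'M[scalarD R D]_n) (l : 'I_n -> R),
    [/\ U *m conjtrmx U = 1%:M,
        forall i, 0 < l i,
        X = U *m real_diag l *m conjtrmx U
      & Y = U *m real_diag (f \o l) *m conjtrmx U].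

(* f(X); meaningful for X positive definite. Only the values of f on
   (0, +oo) matter. *)
Definition mxfun (f : R -> R) n (X : 'M[scalarD R D]_n) : 'M[scalarD R D]_n :=
  xget 0 [set Y | is_mxfun f X Y].

Definition mxpow n (X : 'M[scalarD R D]_n) (s : R) : 'M[scalarD R D]_n :=
  mxfun (fun t => t `^ s) X.

Definition geomean n (A B : 'M[scalarD R D]_n) : 'M[scalarD R D]_n :=
  let P := mxpow A (2^-1) in
  let Q := mxpow A (- 2^-1) in
  P *m mxpow (Q *m B *m Q) (2^-1) *m P.

Definition altmean (f : R -> R) n (A B : 'M[scalarD R D]_n) :
    'M[scalarD R D]_n :=
  let F := mxfun f (geomean (invmxD A) B) in
  F *m A *m F.

Definition linearizable (f : R -> R) n (A B : 'M[scalarD R D]_n) : Prop :=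
  exists a b : R, altmean f A B = of_real D a *: A + of_real D b *: B.

End Matrices.

Definition strictly_convex_on (R : realType) (S : set R) (g : R -> R) : Prop :=
  forall x y t : R, S x -> S y -> x != y -> 0 < t -> t < 1 ->
    g (t * x + (1 - t) * y) < t * g x + (1 - t) * g y.

Definition strictly_concave_on (R : realType) (S : set R) (g : R -> R) : Prop :=
  forall x y t : R, S x -> S y -> x != y -> 0 < t -> t < 1 ->
    t * g x + (1 - t) * g y < g (t * x + (1 - t) * y).

(* Main.v *)
(** The realification of M_n(D), which replaces each entry by the matrix of its
left multiplication in an orthonormal real basis of D, is an injective ring
homomorphism turning conjugate transposes into transposes. Over all three D it
therefore yields that one-sided inverses are two-sided, and that commuting
Hermitian A, B have a common eigenvector with real eigenvalues. Deflating by a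
Householder reflection diagonalizes them simultaneously: A = U diag(a) U^*,
B = U diag(b) U^*. Then, with t_i = b_i / a_i, the alternative mean is
U diag(a_i g(t_i)) U^* and Spec(A^-1 B) is the set of the t_i, so linearizability
means that g agrees with an affine function on that set; a strictly convex or
concave function does so exactly on sets of at most two points. *)
From HB Require Import structures.
Require Import Defs.
From mathcomp Require Import all_boot all_order all_algebra.
From mathcomp Require Import complex ring lra spectral.
From mathcomp Require Import all_classical all_reals all_analysis.

Import Order.TTheory GRing.Theory Num.Theory.
Import numFieldNormedType.Exports.

Set Implicit Arguments.
Unset Strict Implicit.
Unset Printing Implicit Defensive.

Local Open Scope classical_set_scope.
Local Open Scope ring_scope.

(** * The scalars *)

Section Scalars.
Variables (R : realType) (D : scalar_kind).
Local Notation K := (scalarD R D).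

Lemma conjD_additive : zmod_morphism (@conjD R D).
Proof.
case: D => [x y|x y|[? ? ? ?] [? ? ? ?]] //=; first exact: rmorphB.
by congr Quat; ring.
Qed.

HB.instance Definition _ :=
  GRing.isZmodMorphism.Build K K (@conjD R D) conjD_additive.

Lemma of_real_additive : zmod_morphism (@of_real R D).
Proof.
case: D => [x y|x y|x y] //=; first exact: (rmorphB (real_complex R)).
by congr Quat; rewrite subr0.
Qed.

HB.instance Definition _ :=
  GRing.isZmodMorphism.Build R K (@of_real R D) of_real_additive.

Lemma of_real_multiplicative : monoid_morphism (@of_real R D).
Proof.
case: D; split=> [|x y] //=; first exact: (rmorphM (real_complex R)).
by congr Quat; rewrite ?(mul0r, mulr0, subr0, addr0).
Qed.

HB.instance Definition _ :=
  GRing.isMonoidMorphism.Build R K (@of_real R D) of_real_multiplicative.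

Lemma conjDM (x y : K) : conjD (x * y) = conjD y * conjD x.
Proof.
case: D x y => [x y|x y|[? ? ? ?] [? ? ? ?]] /=; first exact: mulrC.
  by rewrite rmorphM mulrC.
by congr Quat; ring.
Qed.

Lemma conjDK : involutive (@conjD R D).
Proof. by case: D => [//||[? ? ? ?]] /=; [exact: conjcK|rewrite !opprK]. Qed.

Lemma conjD_real (r : R) : conjD (of_real D r) = of_real D r.
Proof. by case: D => //=; rewrite ?oppr0. Qed.

Lemma of_real_comm (r : R) (x : K) : of_real D r * x = x * of_real D r.
Proof.
case: D x => [x|x|[? ? ? ?]] /=; [exact: mulrC|exact: mulrC|].
by congr Quat; ring.
Qed.

Lemma of_real_inj : injective (@of_real R D).
Proof. by case: D => x y // []. Qed.

Definition reD : K -> R :=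
  match D return scalarD R D -> R with
  | RealScalars => fun x => x
  | ComplexScalars => fun z => complex.Re z
  | QuaternionScalars => fun q => qre q
  end.

Lemma reD_additive : zmod_morphism reD.
Proof. by rewrite /reD; case: D => [x y|[? ?] [? ?]|[? ? ? ?] [? ? ? ?]]. Qed.

HB.instance Definition _ := GRing.isZmodMorphism.Build K R reD reD_additive.

Lemma reD_of_real (r : R) : reD (of_real D r) = r.
Proof. by rewrite /reD; case: D. Qed.

Lemma reD_conj (x : K) : reD (conjD x) = reD x.
Proof. by rewrite /reD; case: D x => [x|[? ?]|[? ? ? ?]]. Qed.

Lemma reDZ (r : R) (x : K) : reD (of_real D r * x) = r * reD x.
Proof.
by rewrite /reD; case: D x => [x|[? ?]|[? ? ? ?]] //=; rewrite ?mul0r ?subr0.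
Qed.

Lemma conjD_self_real (x : K) : conjD x = x -> x = of_real D (reD x).
Proof.
rewrite /reD; case: D x => [//|[a b]|[a b c d]] /= [].
  by move=> h; congr Complex; lra.
by move=> h1 h2 h3; congr Quat; lra.
Qed.

Definition normsqD (x : K) : R := reD (conjD x * x).

Lemma conjD_mulE (x : K) : conjD x * x = of_real D (normsqD x).
Proof. by apply: conjD_self_real; rewrite conjDM conjDK. Qed.

Lemma normsqD_ge0 (x : K) : 0 <= normsqD x.
Proof.
rewrite /normsqD /reD; case: D x => [x|[a b]|[a b c d]] /=; nra.
Qed.

Lemma normsqD_eq0 (x : K) : normsqD x = 0 -> x = 0.
Proof.
rewrite /normsqD /reD; case: D x => [x|[a b]|[a b c d]] /= h.
- by apply/eqP; rewrite -sqrf_eq0 expr2 h.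
- by congr Complex; nra.
- by congr Quat; nra.
Qed.

Lemma normsqD_conj (x : K) : normsqD (conjD x) = normsqD x.
Proof.
rewrite /normsqD conjDK /reD.
by case: D x => [//|[a b]|[a b c d]] /=; ring.
Qed.

(** A nonzero x has the left inverse $\bar x/|x|^2$, because $\bar x x=|x|^2$ is real; commutativity
    does not enter. *)
Lemma mulD_eq0 (x y : K) : x * y = 0 -> x = 0 \/ y = 0.
Proof.
move=> xy0; have [x0|x0] := eqVneq (normsqD x) 0.
  by left; exact: normsqD_eq0.
right; rewrite -[y]mul1r -(rmorph1 (@of_real R D)) -(mulVf x0) rmorphM /= -mulrA.
by rewrite -conjD_mulE -(mulrA (conjD x)) xy0 !mulr0.
Qed.

Definition dimD : nat :=
  match D with
  | RealScalars => 1
  | ComplexScalars => 2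
  | QuaternionScalars => 4
  end.

Definition basisD (k : 'I_dimD) : K :=
  match D return scalarD R D with
  | RealScalars => 1
  | ComplexScalars => Complex (k == 0%N :> nat)%:R (k == 1%N :> nat)%:R
  | QuaternionScalars =>
      Quat (k == 0%N :> nat)%:R (k == 1%N :> nat)%:R
           (k == 2%N :> nat)%:R (k == 3%N :> nat)%:R
  end.

(** The real inner product $\mathrm{Re}(\bar e_k x)$ with a basis element; this form makes adjoints
    of left multiplications easy to compute. *)
Definition coordD (k : 'I_dimD) (x : K) : R := reD (conjD (basisD k) * x).

Lemma coordD_additive k : zmod_morphism (coordD k).
Proof. by move=> x y; rewrite /coordD mulrBr raddfB. Qed.

HB.instance Definition _ k :=
  GRing.isZmodMorphism.Build K R (coordD k) (coordD_additive k).

End Scalars.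

Arguments basisD {R D} k.

Section Coordinates.
Variables (R : realType) (D : scalar_kind).
Local Notation K := (scalarD R D).

Lemma coordDE (x : K) : x = \sum_k basisD k * of_real D (coordD k x).
Proof.
rewrite /coordD /basisD /reD; case: D x => [x|[a b]|[a b c d]].
- by rewrite big_ord1 /= !mul1r.
- by rewrite 2!big_ord_recl big_ord0 /=; congr Complex => /=; ring.
- by rewrite 4!big_ord_recl big_ord0 /=; congr Quat => /=; ring.
Qed.

Lemma coordD_basis (k l : 'I_(dimD D)) : coordD k (basisD l : K) = (k == l)%:R.
Proof.
rewrite /coordD /basisD /reD; case: D k l => [k l|k l|k l].
- by case: k l => [[|?] ?] [[|?] ?] //=; rewrite mulr1.
- by case: k l => [[|[|?]] ?] [[|[|?]] ?] //=; ring.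
- by case: k l => [[|[|[|[|?]]]] ?] [[|[|[|[|?]]]] ?] //=; ring.
Qed.

Lemma coordDZ k (r : R) (x : K) : coordD k (x * of_real D r) = coordD k x * r.
Proof.
by rewrite /coordD -of_real_comm mulrA -of_real_comm -mulrA reDZ mulrC.
Qed.

Lemma coordD_inj (x y : K) : (forall k, coordD k x = coordD k y) -> x = y.
Proof.
by move=> h; rewrite (coordDE x) (coordDE y); apply: eq_bigr => k _; rewrite h.
Qed.

End Coordinates.

(** * Realification *)

(** Indices of realified matrices are ordinals encoding pairs (matrix index, coordinate), so sums in
    their products must be split. *)
Lemma sum_enum_val (V : nmodType) (I J : finType) (F : I * J -> V) :
  \sum_(p < #|{: I * J}|) F (enum_val p) = \sum_i \sum_j F (i, j).
Proof.
rewrite -(big_enum_val (A := predT)) pair_bigA.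
by apply: eq_big => [[]|[]].
Qed.

Section ConjugateTranspose.
Variables (R : realType) (D : scalar_kind).
Local Notation K := (scalarD R D).

Lemma conjtrmxK m n (A : 'M[K]_(m, n)) : conjtrmx (conjtrmx A) = A.
Proof. by apply/matrixP => i j; rewrite !mxE conjDK. Qed.

Lemma conjtrmxM m n p (A : 'M[K]_(m, n)) (B : 'M[K]_(n, p)) :
  conjtrmx (A *m B) = conjtrmx B *m conjtrmx A.
Proof.
apply/matrixP => i j; rewrite !mxE raddf_sum /=; apply: eq_bigr => k _.
by rewrite !mxE conjDM.
Qed.

Lemma conjtrmxB m n (A B : 'M[K]_(m, n)) :
  conjtrmx (A - B) = conjtrmx A - conjtrmx B.
Proof. by apply/matrixP => i j; rewrite !mxE raddfB. Qed.

Lemma conjtrmxZ m n (r : R) (A : 'M[K]_(m, n)) :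
  conjtrmx (of_real D r *: A) = of_real D r *: conjtrmx A.
Proof. by apply/matrixP => i j; rewrite !mxE conjDM conjD_real of_real_comm. Qed.

Lemma conjtrmx1 n : conjtrmx (1%:M : 'M[K]_n) = 1%:M.
Proof.
by apply/matrixP => i j; rewrite !mxE eq_sym -(rmorph_nat (of_real D)) conjD_real.
Qed.

Lemma conjtrmx_block m1 m2 n1 n2 (Aul : 'M[K]_(m1, n1)) (Aur : 'M[K]_(m1, n2))
    (Adl : 'M[K]_(m2, n1)) (Adr : 'M[K]_(m2, n2)) :
  conjtrmx (block_mx Aul Aur Adl Adr) =
  block_mx (conjtrmx Aul) (conjtrmx Adl) (conjtrmx Aur) (conjtrmx Adr).
Proof. by rewrite /conjtrmx tr_block_mx map_block_mx. Qed.

(** Real scalars are central in D, so they move across A; an arbitrary quaternion would not. *)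
Lemma mulmxZr m n p (r : R) (A : 'M[K]_(m, n)) (B : 'M[K]_(n, p)) :
  A *m (of_real D r *: B) = of_real D r *: (A *m B).
Proof.
apply/matrixP => i j; rewrite !mxE mulr_sumr; apply: eq_bigr => k _.
by rewrite mxE !mulrA of_real_comm.
Qed.

Lemma conjtrmx_mul_self n (x : 'cV[K]_n) :
  conjtrmx x *m x = (of_real D (\sum_i normsqD (x i 0)))%:M.
Proof.
apply/matrixP => i j; rewrite !ord1 !mxE mulr1n rmorph_sum.
by apply: eq_bigr => k _; rewrite !mxE conjD_mulE.
Qed.

Lemma sum_normsqD_eq0 n (x : 'cV[K]_n) :
  \sum_i normsqD (x i 0) = 0 -> x = 0.
Proof.
move=> h; apply/matrixP => i j; rewrite ord1 mxE; apply: normsqD_eq0.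
by apply: (psumr_eq0P _ h) => // k _; exact: normsqD_ge0.
Qed.

End ConjugateTranspose.

Section Realification.
Variables (R : realType) (D : scalar_kind) (n : nat).
Local Notation K := (scalarD R D).
Local Notation N := #|{: 'I_n * 'I_(dimD D)}|.

(** The numbers [coordD k (x * basisD l)] are the entries of the matrix of left multiplication by x;
    this is what makes [realify] multiplicative. *)
Lemma coordDM k (x y : K) :
  coordD k (x * y) = \sum_l coordD k (x * basisD l) * coordD l y.
Proof.
rewrite {1}(coordDE y) mulr_sumr raddf_sum /=.
by apply: eq_bigr => l _; rewrite mulrA coordDZ.
Qed.

Definition realify (A : 'M[K]_n) : 'M[R]_N :=
  \matrix_(p, q) coordD (enum_val p).2
    (A (enum_val p).1 (enum_val q).1 * basisD (enum_val q).2).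

Definition unrealify (v : 'cV[R]_N) : 'cV[K]_n :=
  \col_i \sum_k basisD k * of_real D (v (enum_rank (i, k)) 0).

Lemma coord_unrealify v i k :
  coordD k (unrealify v i 0) = v (enum_rank (i, k)) 0.
Proof.
rewrite mxE raddf_sum /= (bigD1 k) //= coordDZ coordD_basis eqxx mul1r.
rewrite big1 ?addr0// => l lk.
by rewrite coordDZ coordD_basis eq_sym (negbTE lk) mul0r.
Qed.

Lemma realify_mul_col A v i k :
  coordD k ((A *m unrealify v) i 0) = (realify A *m v) (enum_rank (i, k)) 0.
Proof.
pose F (x : 'I_n * 'I_(dimD D)) :=
  coordD k (A i x.1 * basisD x.2) * v (enum_rank x) 0.
have -> : (realify A *m v) (enum_rank (i, k)) 0 = \sum_j \sum_l F (j, l).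
  rewrite -sum_enum_val mxE; apply: eq_bigr => q _.
  by rewrite mxE enum_rankK /F enum_valK.
rewrite mxE raddf_sum /=; apply: eq_bigr => j _; rewrite coordDM.
by apply: eq_bigr => l _; rewrite coord_unrealify.
Qed.

Lemma realifyM A B : realify (A *m B) = realify A *m realify B.
Proof.
apply/matrixP => p q; rewrite !mxE mulr_suml raddf_sum /=.
under [RHS]eq_bigr do rewrite !mxE.
rewrite (sum_enum_val (fun x => coordD (enum_val p).2
   (A (enum_val p).1 x.1 * basisD x.2) *
   coordD x.2 (B x.1 (enum_val q).1 * basisD (enum_val q).2))).
by apply: eq_bigr => j _; rewrite -mulrA coordDM.
Qed.

Lemma realify1 : realify 1%:M = 1%:M.
Proof.
apply/matrixP => p q; rewrite !mxE.
rewrite -(inj_eq enum_val_inj).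
case: (enum_val p) (enum_val q) => [i k] [j l] /=.
rewrite xpair_eqE; case: eqP => _ /=; first by rewrite mul1r coordD_basis.
by rewrite mul0r raddf0.
Qed.

Lemma realify_inj : injective realify.
Proof.
move=> A B /matrixP AB; apply/matrixP => i j; apply: coordD_inj => k.
(* Expanding the factor 1 in the basis expresses the coordinates of an entry through entries of the
   realified matrix. *)
rewrite -[A i j]mulr1 -[B i j]mulr1 !coordDM.
apply: eq_bigr => l _; congr (_ * _).
by have := AB (enum_rank (i, k)) (enum_rank (j, l)); rewrite !mxE !enum_rankK.
Qed.

(** For $\mathrm{Re}(\bar x y)$, left multiplication by $\bar a$ is adjoint to that by a, since
    conjugation preserves real parts and reverses products. *)
Lemma realify_conjtrmx A : realify (conjtrmx A) = (realify A)^T.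
Proof.
apply/matrixP => p q; rewrite !mxE /coordD -reD_conj.
by rewrite !conjDM !conjDK mulrA.
Qed.

Lemma mulmx1C_scalarD (A B : 'M[K]_n) : A *m B = 1%:M -> B *m A = 1%:M.
Proof.
move=> AB1; apply: realify_inj; rewrite realifyM realify1.
by apply: mulmx1C; rewrite -realifyM AB1 realify1.
Qed.

End Realification.

(** * Common eigenvectors of commuting real symmetric matrices *)

Section RealSymmetric.
Variables (R : rcfType) (n : nat).
Local Notation C := (complex R).
Local Notation toC := (map_mx (real_complex R)).

(* w S = a w and S = S^T give a |w|^2 = w S w^* = (conj a) |w|^2. *)
Lemma sym_eigenvalue_real (S : 'M[R]_n) (w : 'rV[C]_n) (a : C) :
  S^T = S -> w != 0 -> w *m toC S = a *: w -> exists r, a = real_complex R r.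
Proof.
move=> Ssym w0 wS; pose wc : 'cV[C]_n := map_mx conjc w^T.
have Swc : toC S *m wc = conjc a *: wc.
  have -> : toC S = map_mx conjc (toC S)^T.
    by rewrite -{1}Ssym; apply/matrixP => i j; rewrite !mxE conjc_real.
  rewrite /wc -map_mxM -trmx_mul wS.
  by apply/matrixP => i j; rewrite !mxE rmorphM.
have /matrixP/(_ 0 0) : w *m toC S *m wc = w *m (toC S *m wc) by rewrite mulmxA.
rewrite wS Swc -scalemxAl -scalemxAr mxE [in RHS]mxE => /eqP.
rewrite -subr_eq0 -mulrBl mulf_eq0 => /orP[|].
  case: a {wS Swc} => a b; rewrite subr_eq0 eq_complex /= => /andP[_ /eqP h].
  by exists a; congr Complex; lra.
(* The factor $ww^*$ is a sum of nonnegative terms, so its vanishing forces w = 0. *)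
rewrite mxE psumr_eq0 => [/allP h|i _]; last by rewrite !mxE mulcJ_ge0.
exfalso; move/eqP: w0; apply; apply/rowP => i.
have := h i (mem_index_enum i); rewrite !mxE /= mulf_eq0 conjc_eq0 orbb.
by move/eqP.
Qed.

(** Commuting complex matrices share an eigenvector. Its eigenvalues are real here, so its real and
    imaginary parts satisfy the same equations, and one of them is nonzero. *)
Lemma common_real_eigenvector (S T : 'M[R]_n) :
  (0 < n)%N -> S^T = S -> T^T = T -> S *m T = T *m S ->
  exists (v : 'cV[R]_n) (a b : R),
    [/\ v != 0, S *m v = a *: v & T *m v = b *: v].
Proof.
move=> n_gt0 Ssym Tsym ST.
have STC : toC S *m toC T = toC T *m toC S by rewrite -!map_mxM ST.
have [w w0 /andP[/sub_rVP[a wS] /sub_rVP[b wT]]] := common_eigenvector2 n_gt0 STC.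
have [r ar] := sym_eigenvalue_real Ssym w0 wS.
have [s bs] := sym_eigenvalue_real Tsym w0 wT.
(* [h] will be the real or the imaginary part; symmetry of [M] turns the row eigenvector into a
   column eigenvector. *)
have part (h : {additive Rcomplex R -> R}) (M : 'M[R]_n) (t : R) :
    (forall (x : R) (z : C), h (real_complex R x * z) = x * h z) ->
    M^T = M -> w *m toC M = real_complex R t *: w ->
    M *m (map_mx h w)^T = t *: (map_mx h w)^T.
  move=> hZ Msym /rowP wM; apply/colP => i; have := congr1 h (wM i).
  rewrite !mxE hZ => <-; rewrite (raddf_sum h); apply: eq_bigr => j _.
  by rewrite !mxE [X in _ = h X]mulrC hZ -{1}Msym mxE.
have ReZ (x : R) (z : C) : complex.Re (real_complex R x * z) = x * complex.Re z.
  by case: z => ? ? /=; rewrite mul0r subr0.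
have ImZ (x : R) (z : C) : complex.Im (real_complex R x * z) = x * complex.Im z.
  by case: z => ? ? /=; rewrite mul0r addr0.
have [Re0|Re_n0] := eqVneq (map_mx (@complex.Re R) w)^T 0; last first.
  exists (map_mx (@complex.Re R) w)^T, r, s; split => //.
    by apply: (part (@complex.Re R)) => //; rewrite -ar.
  by apply: (part (@complex.Re R)) => //; rewrite -bs.
exists (map_mx (@complex.Im R) w)^T, r, s; split.
- apply: contraNneq w0 => Im0; apply/eqP/rowP => i; rewrite mxE.
  move/colP: Re0 => /(_ i); move/colP: Im0 => /(_ i); rewrite !mxE.
  by case: (w 0 i) => /= x y -> ->.
- by apply: (part (@complex.Im R)) => //; rewrite -ar.
- by apply: (part (@complex.Im R)) => //; rewrite -bs.
Qed.

End RealSymmetric.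

(** * Simultaneous diagonalization *)

Section SimultaneousDiagonalization.
Variables (R : realType) (D : scalar_kind).
Local Notation K := (scalarD R D).
Local Notation "r %:D" := (of_real D r) (at level 2, format "r %:D").

Lemma unrealify_eigenvector n (A : 'M[K]_n) v (a : R) :
  realify A *m v = a *: v -> A *m unrealify v = a%:D *: unrealify v.
Proof.
move=> Av; apply/colP => i; apply: coordD_inj => k.
by rewrite realify_mul_col Av !mxE of_real_comm coordDZ -coord_unrealify mxE mulrC.
Qed.

Lemma unrealify_eq0 n (v : 'cV[R]_#|{: 'I_n * 'I_(dimD D)}|) :
  (unrealify v == 0 :> 'cV[K]_n) = (v == 0).
Proof.
apply/eqP/eqP => [/colP v0|->]; apply/colP => i; last first.
  by apply: coordD_inj => k; rewrite coord_unrealify !mxE raddf0.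
have := coord_unrealify v (enum_val i).1 (enum_val i).2.
by rewrite v0 -surjective_pairing enum_valK !mxE raddf0.
Qed.

Lemma common_eigenvector_herm n (A B : 'M[K]_n.+1) :
  hermmx A -> hermmx B -> A *m B = B *m A ->
  exists (x : 'cV[K]_n.+1) (a b : R),
    [/\ x != 0, A *m x = a%:D *: x & B *m x = b%:D *: x].
Proof.
move=> hA hB AB; have N_gt0 : (0 < #|{: 'I_n.+1 * 'I_(dimD D)}|)%N.
  by rewrite card_prod !card_ord; case: (D).
have [||| v [a [b [v0 Av Bv]]]] :=
  @common_real_eigenvector R _ (realify A) (realify B) N_gt0.
- by rewrite -realify_conjtrmx -hA.
- by rewrite -realify_conjtrmx -hB.
- by rewrite -!realifyM AB.
exists (unrealify v), a, b; rewrite unrealify_eq0.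
by split=> //; exact: unrealify_eigenvector.
Qed.

(* Right multiplication by the conjugate of the first entry makes that entry
   real; it commutes with left multiplication by matrices. *)
Lemma normalize_col n (x : 'cV[K]_n.+1) : x != 0 ->
  exists (q : K) (c : R),
    let y := \col_i (x i 0 * q) in y 0 0 = c%:D /\ conjtrmx y *m y = 1%:M.
Proof.
move=> x0.
(* Only the first entry is made real here: [p] is 1 if that entry vanishes and its conjugate
   otherwise. Scaling to unit length follows. *)
have [p [c [z0 zc]]] : exists (p : K) (c : R),
    let z := \col_i (x i 0 * p) in z != 0 /\ z 0 0 = c%:D.
  have [x00|x00] := eqVneq (x 0 0) 0.
    exists 1, 0 => /=; rewrite mxE x00 mul0r raddf0; split=> //.
    by apply: contraNneq x0 => /colP h; apply/eqP/colP => i;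
      have := h i; rewrite !mxE mulr1.
  exists (conjD (x 0 0)), (normsqD (conjD (x 0 0))) => /=.
  rewrite mxE -conjD_mulE conjDK; split=> //.
  apply: contraNneq x00 => /colP/(_ 0); rewrite !mxE -{1}[x 0 0]conjDK conjD_mulE.
  move/eqP; rewrite -[X in _ == X](raddf0 (@of_real R D)) (inj_eq (@of_real_inj R D)).
  by rewrite normsqD_conj => /eqP/normsqD_eq0->.
set z := (\col_i _) in z0 zc.
pose s := \sum_i normsqD (z i 0).
have s_gt0 : 0 < s.
  rewrite lt0r sumr_ge0 ?andbT => [|i _]; last exact: normsqD_ge0.
  by apply: contraNneq z0 => /sum_normsqD_eq0/eqP.
exists (p * ((Num.sqrt s)^-1)%:D), (c * (Num.sqrt s)^-1) => /=.
have -> : \col_i (x i 0 * (p * ((Num.sqrt s)^-1)%:D)) = ((Num.sqrt s)^-1)%:D *: z.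
  by apply/colP => i; rewrite !mxE mulrA -of_real_comm.
split; first by rewrite mxE zc -rmorphM mulrC.
rewrite conjtrmxZ mulmxZr -scalemxAl conjtrmx_mul_self !scale_scalar_mx.
rewrite -!rmorphM; congr (_ %:M); rewrite -(rmorph1 (@of_real R D)).
congr (_ %:D).
by rewrite mulrA -invfM -expr2 sqr_sqrtr ?ltW// mulVf ?gt_eqF.
Qed.

Definition unitarymxD n (U : 'M[K]_n) : Prop :=
  U *m conjtrmx U = 1%:M /\ conjtrmx U *m U = 1%:M.

Lemma unitarymxDM n (U V : 'M[K]_n) :
  unitarymxD U -> unitarymxD V -> unitarymxD (U *m V).
Proof.
move=> [U1 U2] [V1 V2]; rewrite /unitarymxD conjtrmxM; split.
  by rewrite mulmxA -(mulmxA U) V1 mulmx1.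
by rewrite mulmxA -(mulmxA _ _ U) U2 mulmx1.
Qed.

(* A Householder reflection: [y] and the first basis vector are unit vectors
   with real inner product, so 1 - 2 v v^* / |v|^2, with v their difference,
   exchanges them. *)
Lemma householder n (y : 'cV[K]_n.+1) (c : R) :
  y 0 0 = c%:D -> conjtrmx y *m y = 1%:M ->
  exists H : 'M[K]_n.+1,
    [/\ conjtrmx H = H, H *m H = 1%:M & H *m delta_mx 0 0 = y].
Proof.
move=> y0 yy; pose e : 'cV[K]_n.+1 := delta_mx 0 0.
have ee : conjtrmx e *m e = 1%:M.
  rewrite conjtrmx_mul_self (bigD1 0) //= big1 => [|i i0].
    by rewrite mxE !eqxx addr0 /normsqD -{1}(rmorph1 (@of_real R D)) conjD_real
      mulr1 reD_of_real rmorph1.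
  by rewrite mxE (negbTE i0) /normsqD mulr0 raddf0.
have ce : conjtrmx e = delta_mx 0 0.
  apply/matrixP => i j; rewrite !mxE andbC.
  by rewrite -(rmorph_nat (@of_real R D)) conjD_real.
have ey : conjtrmx e *m y = (c%:D)%:M.
  apply/matrixP => i j; rewrite !ord1 ce -rowE !mxE.
  by rewrite y0.
have ye : conjtrmx y *m e = (c%:D)%:M.
  rewrite -[e]conjtrmxK -conjtrmxM ey; apply/matrixP => i j.
  by rewrite !ord1 !mxE mulr1n conjD_real.
(* For unit vectors y and e with inner product c, s is $|y-e|^2$. *)
pose v := y - e; pose s : R := 2 - 2 * c.
have vv : conjtrmx v *m v = (s%:D)%:M.
  rewrite conjtrmxB mulmxBl !mulmxBr yy ey ye ee.
  apply/matrixP => i j; rewrite !ord1 !mxE !mulr1n -(rmorph1 (@of_real R D)).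
  by rewrite -!raddfB; congr (_ %:D); rewrite /s; ring.
have ve : conjtrmx v *m e = ((- (s / 2))%:D)%:M.
  rewrite conjtrmxB mulmxBl ye ee.
  apply/matrixP => i j; rewrite !ord1 !mxE !mulr1n -(rmorph1 (@of_real R D)).
  by rewrite -!raddfB; congr (_ %:D); rewrite /s; field.
(* If s = 0, then y = e and the identity serves; otherwise division by s is allowed. *)
have [s0|s0] := eqVneq s 0.
  exists 1%:M; rewrite conjtrmx1 !mul1mx; split=> //.
  move: vv; rewrite conjtrmx_mul_self s0 => /matrixP/(_ 0 0).
  rewrite !mxE !mulr1n => /of_real_inj/sum_normsqD_eq0/eqP.
  by rewrite subr_eq0 => /eqP.
pose P := v *m conjtrmx v.
have PP : P *m P = s%:D *: P.
  by rewrite /P mulmxA -(mulmxA v) vv -mulmxA mul_scalar_mx mulmxZr.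
have cP : conjtrmx P = P by rewrite conjtrmxM conjtrmxK.
exists (1%:M - (2 / s)%:D *: P); split.
- by rewrite conjtrmxB conjtrmx1 conjtrmxZ cP.
(* With $\tau=2/s$, $(1-\tau P)^2=1-2\tau P+\tau^2 sP$, and $\tau^2 s=2\tau$. *)
- rewrite mulmxBl mul1mx mulmxBr mulmx1 mulmxZr -!scalemxAl PP !scalerA.
  rewrite -!rmorphM (_ : 2 / s * (2 / s) * s = 2 / s + 2 / s); last by field.
  by rewrite rmorphD scalerDl opprB addrK subrK.
(* As $v^*e=-s/2$, the reflection sends e to $e+v=y$. *)
- rewrite mulmxBl mul1mx -scalemxAl -mulmxA ve.
  apply/colP => i; rewrite !mxE big_ord1 !mxE mulr1n -of_real_comm mulrA -rmorphM.
  rewrite (_ : 2 / s * - (s / 2) = -1); last by field.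
  by rewrite rmorphN1 mulN1r opprK addrCA subrr addr0.
Qed.

(** The eigenvector equation determines the first column, and Hermitian symmetry then clears the
    first row. *)
Lemma herm_deflate m (M : 'M[K]_m.+1) (a : R) :
  hermmx M -> M *m delta_mx 0 0 = a%:D *: delta_mx 0 0 :> 'cV[K]_m.+1 ->
  let M' := drsubmx (M : 'M[K]_(1 + m)) in
  M = block_mx (a%:D)%:M 0 0 M' :> 'M[K]_(1 + m) /\ hermmx M'.
Proof.
move=> hM; rewrite -colE => /colP Me M'.
have dr : hermmx M'.
  by apply/matrixP => i j; rewrite /M' {1}hM !mxE.
split=> //.
have dl : dlsubmx (M : 'M[K]_(1 + m)) = 0.
  apply/matrixP => i j; have := Me (rshift 1 i).
  by rewrite ord1 !mxE /= mulr0 => <-; congr (M _ _); exact: val_inj.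
rewrite -[LHS](@submxK _ 1 m 1 m) dl; congr block_mx.
  apply/matrixP => i j; have := Me 0.
  rewrite !ord1 !mxE /= mulr1 mulr1n => <-.
  by congr (M _ _); exact: val_inj.
apply/matrixP => i j; rewrite hM !mxE.
by move/matrixP: dl => /(_ j i); rewrite !mxE => ->; rewrite raddf0.
Qed.

Lemma real_diag_split m (a : R) (l : 'I_m -> R) :
  real_diag D (fun i : 'I_(1 + m) =>
    match fintype.split i with inl _ => a | inr j => l j end) =
  block_mx (a%:D)%:M 0 0 (real_diag D l).
Proof.
rewrite /real_diag -diag_const_mx -diag_mx_row; congr diag_mx.
by apply/rowP => i; rewrite !mxE; case: fintype.split => j; rewrite mxE.
Qed.

Theorem simultaneous_diagonalization n (A B : 'M[K]_n) :
  hermmx A -> hermmx B -> A *m B = B *m A ->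
  exists (U : 'M[K]_n) (a b : 'I_n -> R),
    [/\ unitarymxD U, A = U *m real_diag D a *m conjtrmx U
      & B = U *m real_diag D b *m conjtrmx U].
Proof.
elim: n A B => [|m IHm] A B hA hB AB.
  exists 1%:M, (fun=> 0), (fun=> 0).
  by split; [split|..]; rewrite [LHS]flatmx0 [RHS]flatmx0.
have [x [a [b [x0 Ax Bx]]]] := common_eigenvector_herm hA hB AB.
have [q [c [y0 yy]]] := normalize_col x0.
set y := (\col_i _) in y0 yy.
(* y is x multiplied by q on the right, while [M] and [t] act on the left, so associativity
   suffices. *)
have colq (M : 'M[K]_m.+1) (t : R) : M *m x = t%:D *: x -> M *m y = t%:D *: y.
  move=> /colP Mx; apply/colP => i; have := congr1 ( *%R^~ q) (Mx i).
  rewrite !mxE mulr_suml mulrA => <-.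
  by apply: eq_bigr => j _; rewrite mxE mulrA.
have [H [cH HH He]] := householder y0 yy.
have Hy : H *m y = delta_mx 0 0 by rewrite -He mulmxA HH mul1mx.
have deflate (M : 'M[K]_m.+1) t : hermmx M -> M *m x = t%:D *: x ->
    let M' := drsubmx (H *m M *m H : 'M[K]_(1 + m)) in
    H *m M *m H = block_mx (t%:D)%:M 0 0 M' :> 'M[K]_(1 + m) /\ hermmx M'.
  move=> hM Mx; apply: herm_deflate.
    by rewrite /hermmx !conjtrmxM cH -hM mulmxA.
  by rewrite -mulmxA He -mulmxA (colq _ _ Mx) mulmxZr Hy.
have [eA hA'] := deflate A a hA Ax; have [eB hB'] := deflate B b hB Bx.
set A' := drsubmx _ in eA hA'; set B' := drsubmx _ in eB hB'.
(* Conjugation by the involution [H] preserves commutation; the lower right blocks inherit it. *)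
have AB' : A' *m B' = B' *m A'.
  have : (H *m A *m H) *m (H *m B *m H) = (H *m B *m H) *m (H *m A *m H).
    rewrite !mulmxA -(mulmxA _ H H) HH mulmx1 -(mulmxA _ H H) HH mulmx1.
    by rewrite -(mulmxA _ A) AB mulmxA.
  rewrite eA eB !(@mulmx_block _ 1 m 1 m 1 m) => /(@eq_block_mx _ 1 m 1 m)[_ _ _].
  by rewrite !mul0mx !add0r.
have [V [a' [b' [[V1 V2] eA' eB']]]] := IHm A' B' hA' hB' AB'.
pose W : 'M[K]_(1 + m) := block_mx 1%:M 0 0 V.
have cW : conjtrmx W = block_mx 1%:M 0 0 (conjtrmx V).
  rewrite conjtrmx_block conjtrmx1; congr block_mx;
  by apply/matrixP => i j; rewrite !mxE raddf0.
have uW : unitarymxD W.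
  split; rewrite cW (@mulmx_block _ 1 m 1 m 1 m) ?V1 ?V2 !mulmx0 !mul0mx;
  by rewrite mulmx1 !addr0 !add0r -scalar_mx_block.
(* Since $H^2=1$, $M=H(HMH)H$, and [W] diagonalizes the middle factor. *)
have undo (M : 'M[K]_m.+1) t M' (l : 'I_m -> R) :
    H *m M *m H = block_mx (t%:D)%:M 0 0 M' :> 'M[K]_(1 + m) ->
    M' = V *m real_diag D l *m conjtrmx V ->
    M = (H *m W) *m real_diag D (fun i : 'I_(1 + m) =>
      match fintype.split i with inl _ => t | inr j => l j end) *m conjtrmx (H *m W).
  move=> eM eM'; set d := real_diag D _.
  have Wd : W *m d *m conjtrmx W = H *m M *m H.
    rewrite /d real_diag_split cW eM eM' !(@mulmx_block _ 1 m 1 m 1 m).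
    by rewrite !(mulmx0, mul0mx, mul1mx, mulmx1, addr0, add0r).
  rewrite conjtrmxM cH !mulmxA -(mulmxA H W) -(mulmxA H) Wd !mulmxA HH mul1mx.
  by rewrite -mulmxA HH mulmx1.
exists (H *m W).
exists (fun i => match fintype.split (i : 'I_(1 + m)) with inl _ => a | inr j => a' j end).
exists (fun i => match fintype.split (i : 'I_(1 + m)) with inl _ => b | inr j => b' j end).
split; [|exact: undo eA eA'|exact: undo eB eB'].
by apply: unitarymxDM => //; split; rewrite cH.
Qed.

End SimultaneousDiagonalization.

(** * Means of simultaneously diagonalized matrices *)

Section Diagonalized.
Variables (R : realType) (D : scalar_kind) (n : nat).
Local Notation K := (scalarD R D).
Local Notation "r %:D" := (of_real D r) (at level 2, format "r %:D").

(** For a fixed unitary U, matrix operations on these matrices become pointwise operations on l; the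
    means are computed by this calculus. *)
Definition conjdiag (U : 'M[K]_n) (l : 'I_n -> R) : 'M[K]_n :=
  U *m real_diag D l *m conjtrmx U.

Lemma conjdiag1 U : unitarymxD U -> conjdiag U (fun=> 1) = 1%:M.
Proof.
move=> [U1 _]; rewrite /conjdiag (_ : real_diag D _ = 1%:M) ?mulmx1//.
by rewrite -diag_const_mx; congr diag_mx; apply/rowP => i; rewrite !mxE rmorph1.
Qed.

Lemma conjdiagM U (k l : 'I_n -> R) : unitarymxD U ->
  conjdiag U k *m conjdiag U l = conjdiag U (fun i => k i * l i).
Proof.
move=> [_ U2]; rewrite /conjdiag -!mulmxA (mulmxA _ U) U2 mul1mx.
rewrite (mulmxA (real_diag _ _)) mulmx_diag; congr (_ *m (diag_mx _ *m _)).
by apply/rowP => i; rewrite !mxE rmorphM.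
Qed.

Lemma conjdiagD U (k l : 'I_n -> R) :
  conjdiag U k + conjdiag U l = conjdiag U (fun i => k i + l i).
Proof.
rewrite /conjdiag -mulmxDl -mulmxDr -raddfD; congr (_ *m diag_mx _ *m _).
by apply/rowP => i; rewrite !mxE rmorphD.
Qed.

Lemma conjdiagZ U (r : R) (l : 'I_n -> R) :
  r%:D *: conjdiag U l = conjdiag U (fun i => r * l i).
Proof.
rewrite /conjdiag scalemxAl -mulmxZr; congr (_ *m _ *m _).
apply/matrixP => i j; rewrite !mxE; case: (i == j).
  by rewrite !mulr1n rmorphM.
by rewrite !mulr0n mulr0.
Qed.

Lemma conjdiag_mul U (l : 'I_n -> R) : unitarymxD U ->
  conjdiag U l *m U = U *m real_diag D l.
Proof. by move=> [_ U2]; rewrite /conjdiag -mulmxA U2 mulmx1. Qed.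

Lemma conjdiagK U (l : 'I_n -> R) : unitarymxD U ->
  conjtrmx U *m conjdiag U l *m U = real_diag D l.
Proof. by move=> uU; rewrite -mulmxA conjdiag_mul// mulmxA uU.2 mul1mx. Qed.

Lemma conjdiag_eq U (k l : 'I_n -> R) : unitarymxD U ->
  conjdiag U k = conjdiag U l <-> k =1 l.
Proof.
move=> uU; split=> [kl|/funext ->//] i.
have /matrixP/(_ i i) : real_diag D k = real_diag D l.
  by rewrite -!(conjdiagK _ uU) kl.
by rewrite !mxE eqxx !mulr1n => /of_real_inj.
Qed.

(** The quadratic form takes the value [l i] at the i-th column of U, which is nonzero because
    $U^*U$ has a 1 at (i,i). *)
Lemma posdef_conjdiag U (l : 'I_n -> R) : unitarymxD U ->
  posdefmx (conjdiag U l) -> forall i, 0 < l i.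
Proof.
move=> uU [_ pos] i; have [_ U2] := uU.
have [|r r_gt0] := pos (col i U).
  apply: contraPneq U2 => Ui0 /matrixP/(_ i i)/eqP.
  rewrite [_ i i](_ : _ = (conjtrmx U *m col i U) i 0).
    by rewrite Ui0 mulmx0 !mxE eqxx eq_sym oner_eq0.
  by rewrite !mxE; apply: eq_bigr => k _; rewrite !mxE.
have -> : conjtrmx (col i U) *m conjdiag U l *m col i U =
    conjtrmx (delta_mx i 0) *m real_diag D l *m delta_mx i 0.
  by rewrite -(conjdiagK _ uU) colE conjtrmxM !mulmxA.
move=> /matrixP/(_ 0 0).
rewrite -colE !mxE (bigD1 i)//= big1 => [|j ji].
  rewrite !mxE !eqxx addr0 !mulr1n -(rmorph1 (@of_real R D)) conjD_real.
  by rewrite rmorph1 mul1r => /of_real_inj ->.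
rewrite !mxE (negbTE ji) /= raddf0 mul0r; exact: erefl.
Qed.

(* W = V^* U satisfies W diag(l) = diag(k) W, so W_ij <> 0 forces l_j = k_i, and
   W intertwines diag(f l) and diag(f k) as well. *)
Lemma mxfun_conjdiag f U (l : 'I_n -> R) : unitarymxD U -> (forall i, 0 < l i) ->
  mxfun f (conjdiag U l) = conjdiag U (f \o l).
Proof.
move=> uU l_gt0; have [U1 U2] := uU; apply: xget_unique; first by exists U, l.
move=> _ [V [k [V1 _ UV ->]]]; have V2 := mulmx1C_scalarD V1.
pose W := conjtrmx V *m U.
have WlkW : W *m real_diag D l = real_diag D k *m W.
  rewrite /W -mulmxA -conjdiag_mul// UV -!mulmxA (mulmxA _ V) V2 mul1mx.
  by rewrite mulmxA.
have WfkW : W *m real_diag D (f \o l) = real_diag D (f \o k) *m W.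
  apply/matrixP => i j; move/matrixP: WlkW => /(_ i j).
  rewrite !mul_mx_diag !mul_diag_mx !mxE /= -!of_real_comm => h.
  set w := (\sum_k0 _) in h *.
  have : (l j - k i)%:D * w = 0 by rewrite raddfB mulrBl h subrr.
  move=> /mulD_eq0[|->]; last by rewrite !mulr0.
  by rewrite raddfB => /subr0_eq/of_real_inj ->.
rewrite /conjdiag -[RHS]mul1mx -V1 -!mulmxA (mulmxA (conjtrmx V)) -/W.
by rewrite (mulmxA W) WfkW -!mulmxA U1 mulmx1.
Qed.

Lemma invmxD_conjdiag U (l : 'I_n -> R) : unitarymxD U -> (forall i, 0 < l i) ->
  invmxD (conjdiag U l) = conjdiag U (fun i => (l i)^-1).
Proof.
move=> uU l_gt0.
have ll : conjdiag U l *m conjdiag U (fun i => (l i)^-1) = 1%:M.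
  rewrite conjdiagM// -(conjdiag1 uU); apply/conjdiag_eq => // i.
  by rewrite divff// gt_eqF.
apply: xget_unique; first by split=> //; exact: mulmx1C_scalarD.
move=> Y [_ Yl]; by rewrite -[LHS]mulmx1 -ll mulmxA Yl mul1mx.
Qed.

Lemma geomean_conjdiag U (a b : 'I_n -> R) : unitarymxD U ->
  (forall i, 0 < a i) -> (forall i, 0 < b i) ->
  geomean (conjdiag U a) (conjdiag U b) = conjdiag U (fun i => Num.sqrt (a i * b i)).
Proof.
move=> uU a_gt0 b_gt0; rewrite /geomean /mxpow !mxfun_conjdiag// !conjdiagM//.
rewrite mxfun_conjdiag// => [|i]; last by rewrite /= !mulr_gt0// powR_gt0.
rewrite !conjdiagM//; apply/conjdiag_eq => // i /=.
have a_ge0 := ltW (a_gt0 i); have b_ge0 := ltW (b_gt0 i).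
rewrite powRN powR12_sqrt//.
have sa : 0 < Num.sqrt (a i) by rewrite sqrtr_gt0.
have -> : (Num.sqrt (a i))^-1 * b i / Num.sqrt (a i) =
  (Num.sqrt (a i))^-1 ^+ 2 * b i by ring.
rewrite powR12_sqrt ?mulr_ge0 ?sqr_ge0// sqrtrM ?sqr_ge0//.
rewrite sqrtr_sqr ger0_norm ?invr_ge0// sqrtrM//.
by field; rewrite gt_eqF.
Qed.

(** $A^{-1}\sharp B$ has eigenvalues $\sqrt{b_i/a_i}$, and the two outer factors square f there:
    this is where $g(b_i/a_i)$ arises. *)
Lemma altmean_conjdiag f U (a b : 'I_n -> R) : unitarymxD U ->
  (forall i, 0 < a i) -> (forall i, 0 < b i) ->
  altmean f (conjdiag U a) (conjdiag U b) =
  conjdiag U (fun i => a i * f (Num.sqrt (b i / a i)) ^+ 2).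
Proof.
move=> uU a_gt0 b_gt0; rewrite /altmean invmxD_conjdiag//.
rewrite geomean_conjdiag// => [|i]; last by rewrite invr_gt0.
rewrite mxfun_conjdiag// => [|i]; last by rewrite sqrtr_gt0 mulr_gt0 ?invr_gt0.
rewrite !conjdiagM//; apply/conjdiag_eq => // i /=.
by rewrite [_^-1 * _]mulrC; ring.
Qed.

(** Compare eigenvalues and divide the i-th equation by $a_i>0$. *)
Lemma linearizable_conjdiag f U (a b : 'I_n -> R) : unitarymxD U ->
  (forall i, 0 < a i) -> (forall i, 0 < b i) ->
  linearizable f (conjdiag U a) (conjdiag U b) <->
  exists r s : R, forall i, f (Num.sqrt (b i / a i)) ^+ 2 = r + s * (b i / a i).
Proof.
move=> uU a_gt0 b_gt0; rewrite /linearizable altmean_conjdiag//.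
split=> -[r [s rs]]; exists r, s.
  move: rs; rewrite !conjdiagZ conjdiagD => /conjdiag_eq h i.
  have ai : a i != 0 by rewrite gt_eqF.
  by apply: (mulfI ai); rewrite h//; field.
rewrite !conjdiagZ conjdiagD; apply/conjdiag_eq => // i; rewrite rs.
by field; rewrite gt_eqF.
Qed.

(** If x has right eigenvalue t, then $y=U^*x$ satisfies $l_iy_i=y_it$. Since $l_i$ is central, some
    $y_i\neq0$ cancels and $t=l_i$; so even quaternionic right eigenvalues are real here. *)
Lemma Spec_conjdiag U (l : 'I_n -> R) : unitarymxD U ->
  Spec (conjdiag U l) = range (fun i => (l i)%:D).
Proof.
move=> uU; have [U1 U2] := uU; apply/seteqP; split=> t /=.
  move=> [x x0 Xx]; pose y := conjtrmx U *m x.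
  have y0 : y != 0.
    apply: contraNneq x0 => y0.
    by rewrite -[x]mul1mx -U1 -mulmxA -/y y0 mulmx0.
  have yt : real_diag D l *m y = \col_i (y i 0 * t).
    have := congr1 (mulmx (conjtrmx U)) Xx.
    rewrite /conjdiag -!mulmxA (mulmxA _ U) U2 mul1mx -/y => ->.
    apply/colP => i; rewrite !mxE mulr_suml.
    by apply: eq_bigr => j _; rewrite !mxE mulrA.
  have [i yi] : exists i, y i 0 != 0.
    apply/existsP; apply: contraNT y0 => /existsPn h; apply/eqP/colP => i.
    by rewrite [RHS]mxE; apply/eqP; rewrite -[_ == _]negbK.
  exists i => //; move/colP: yt => /(_ i); rewrite mul_diag_mx [LHS]mxE [RHS]mxE.
  rewrite [X in X * _]mxE of_real_comm => h.
  have : y i 0 * ((l i)%:D - t) = 0 by rewrite mulrBr h subrr.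
  by move=> /mulD_eq0[/eqP|/subr0_eq//]; rewrite (negbTE yi).
move=> [i _ <-]; exists (col i U).
  apply: contraPneq U2 => Ui0 /matrixP/(_ i i)/eqP.
  rewrite [_ i i](_ : _ = (conjtrmx U *m col i U) i 0).
    by rewrite Ui0 mulmx0 !mxE eqxx eq_sym oner_eq0.
  by rewrite !mxE; apply: eq_bigr => k _; rewrite !mxE.
rewrite colE mulmxA conjdiag_mul// -colE.
by apply/colP => j; rewrite -colE mul_mx_diag !mxE.
Qed.

End Diagonalized.

(** * Affine values of strictly convex functions *)

(** Pigeonhole gives one direction. For the other, one value and, if there is one, a second value
    different from it cover the range. *)
Lemma range_card_le2 (T : finType) (U : eqType) (h : T -> U) :
  (range h #<= `I_2)%card <->
  (forall i j k, [|| h i == h j, h j == h k | h i == h k]).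
Proof.
split=> [/pcard_leP/unsquash F i j k|h3].
  have hF (l : T) : F (h l) = 0 \/ F (h l) = 1.
    have : (F (h l) < 2)%N by apply: (@funS _ _ _ _ F); exists l.
    by case: (F (h l)) => [|[|?]] //; [left|right].
  have F_inj (l m : T) : F (h l) = F (h m) -> h l == h m.
    by move=> e; apply/eqP; apply: (@inj _ _ _ F) => //; apply/mem_set.
  case: (hF i) (hF j) (hF k) => ei [] ej [] ek;
  apply/or3P; solve [constructor 1; apply: F_inj; congruence |
    constructor 2; apply: F_inj; congruence |
    constructor 3; apply: F_inj; congruence].
have [i _|T0] := pickP (@predT T); last first.
  rewrite (_ : range h = set0) ?card_ge0//.
  by apply/seteqP; split=> [y [l]|//]; have := T0 l.
have cover y : range h `<=` [set h i; y] -> (range h #<= `I_2)%card.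
  move=> hy; pose G (m : nat) := if m is 0 then h i else y.
  apply: (@card_le_trans _ _ _ (G @` `I_2)); last exact: card_image_le.
  by apply: subset_card_le => z /hy[->|->]; [exists 0%N|exists 1%N].
have [j ji|hi] := pickP (fun j => h j != h i).
  apply: (cover (h j)) => _ [k _ <-].
  by have := h3 i j k; rewrite eq_sym (negbTE ji) /= => /orP[]/eqP ->; [right|left].
apply: (cover (h i)) => _ [k _ <-]; left.
by have /negbFE/eqP := hi k.
Qed.

Lemma convex_not_affine3 (R : realType) (g : R -> R) (r s x y z : R) :
  strictly_convex_on [set t : R | 0 < t] g \/
  strictly_concave_on [set t : R | 0 < t] g ->
  0 < x -> x < y -> y < z ->
  g x = r + s * x -> g y = r + s * y -> g z = r + s * z -> False.
Proof.
move=> g_conv x0 xy yz gx gy gz.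
have xz := lt_trans xy yz; have zx : z - x != 0 by rewrite subr_eq0 gt_eqF.
(* The weight that makes y a convex combination of x and z; affine values would give equality in the
   strict inequality. *)
pose t := (z - y) / (z - x).
have t0 : 0 < t by rewrite divr_gt0 ?subr_gt0.
have t1 : t < 1 by rewrite ltr_pdivrMr ?subr_gt0// mul1r; lra.
have yE : t * x + (1 - t) * z = y by rewrite /t; field.
have gE : t * g x + (1 - t) * g z = g y.
  by rewrite gx gz gy -yE; ring.
have xNz : x != z by rewrite lt_eqF.
have z0 := lt_trans x0 xz.
case: g_conv => /(_ x z t x0 z0 xNz t0 t1); rewrite yE gE ltxx //.
Qed.

Lemma affine_on_le2_values (R : realType) (T : finType) (h : T -> R) (g : R -> R) :
  (forall i, 0 < h i) ->
  strictly_convex_on [set t : R | 0 < t] g \/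
  strictly_concave_on [set t : R | 0 < t] g ->
  (exists r s : R, forall i, g (h i) = r + s * h i) <->
  (forall i j k, [|| h i == h j, h j == h k | h i == h k]).
Proof.
move=> h0 g_conv; split=> [[r [s rs]] i j k|h3].
  have no3 l m p : h l < h m -> h m < h p -> False.
    by move=> lm mp; exact: (convex_not_affine3 g_conv (h0 l) lm mp).
  (* Three distinct values form a strictly increasing chain in some order, which [no3] excludes. *)
  case: (ltgtP (h i) (h j)) => // ij; case: (ltgtP (h j) (h k)) => // jk;
  case: (ltgtP (h i) (h k)) => // ik; exfalso;
  first [exact: no3 ij jk | exact: no3 jk ij | exact: no3 ik jk
       | exact: no3 jk ik | exact: no3 ij ik | exact: no3 ik ij | lra].
have [i _|T0] := pickP (@predT T); last by exists 0, 0 => i; have := T0 i.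
have [j ji|hi] := pickP (fun j => h j != h i); last first.
  exists (g (h i)), 0 => k; have /negbFE/eqP -> := hi k.
  by rewrite mul0r addr0.
have hji : h j - h i != 0 by rewrite subr_eq0.
(* The slope of the secant of g through the two values. *)
pose s := (g (h j) - g (h i)) / (h j - h i).
exists (g (h i) - s * h i), s => k.
have := h3 i j k; rewrite eq_sym (negbTE ji) /= => /orP[]/eqP <-.
  by rewrite /s; field.
by rewrite subrK.
Qed.

Unset Implicit Arguments.

Theorem theorem7p7 (R : realType) (D : scalar_kind) (n : nat)
    (f : R -> R)
    (f_pos : forall t : R, 0 < t -> 0 < f t)
    (f_cont : {within [set t : R | 0 < t], continuous f})
    (f1 : f 1 = 1)
    (A B : 'M[scalarD R D]_n)
    (A_posdef : posdefmx A) (B_posdef : posdefmx B)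
    (AB_comm : A *m B = B *m A)
    (g := fun t : R => f (Num.sqrt t) ^+ 2)
    (g_conv : strictly_convex_on [set t : R | 0 < t] g \/
              strictly_concave_on [set t : R | 0 < t] g) :
  linearizable f A B <-> (Spec (invmxD A *m B) #<= `I_2)%card.
Proof.
have [U [a [b [uU eA eB]]]] :=
  simultaneous_diagonalization A_posdef.1 B_posdef.1 AB_comm.
rewrite -!/(conjdiag _ _) in eA eB; rewrite {}eA {}eB in A_posdef B_posdef *.
have a_gt0 := posdef_conjdiag uU A_posdef.
have b_gt0 := posdef_conjdiag uU B_posdef.
rewrite linearizable_conjdiag// invmxD_conjdiag// conjdiagM// Spec_conjdiag//.
rewrite range_card_le2 (affine_on_le2_values (h := fun i => b i / a i) _ g_conv).
  (* Both sides now say that among any three ratios two coincide, for ratios in D on one side and in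
     R on the other. *)
  have E i j : (of_real D ((a i)^-1 * b i) == of_real D ((a j)^-1 * b j)) =
      (b i / a i == b j / a j).
    by rewrite (inj_eq (@of_real_inj R D)) ![_^-1 * _]mulrC.
  by split=> H i j k; have := H i j k; rewrite !E.
by move=> i; rewrite divr_gt0.
Qed.
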